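(* For an $m\times n$ matrix $A$ and $b\in\mathbb{R}^m$ let $S(A,b):=\{x\in\mathbb{R}^n\mid Ax\le b\}$ and $\mathcal{F}(x,A,b):=-N(x;S(A,b))$. Let $(\bar x,\bar A,\bar b)\in\mathbb{R}^n\times\mathbb{R}^{nm}\times\mathbb{R}^m$ satisfy $\bar A\bar x\le\bar b$, let $\bar v\in\mathcal{F}(\bar x,\bar A,\bar b)$, and suppose that the active rows $\{\bar A_i\mid i\in I(\bar x,\bar A,\bar b)\}$, $I(\bar x,\bar A,\bar b):=\{i\mid\bar A_i\bar x=\bar b_i\}$, are positively linearly independent. For $u\in\mathbb{R}^n$ and $p\in\mathbb{R}^m$ define $$P(u):=\Big\{p\in N_{\mathbb{R}^m_-}(\bar A\bar x-\bar b)\ \Big|\ \bar A^*p=-\bar v,\ u\in\bigcap_{\{i\mid p_i>0\}}\bar A_i^\perp\Big\},$$ $$Q(p):=\left\{q\in\mathbb{R}^m\ \middle|\ \begin{array}{ll}q_i=0&\text{if }\bar A_i\bar x<\bar b_i\text{ or if }\bar A_i\bar x=\bar b_i,\ p_i=0,\ \bar A_iu>0,\\ q_i\ge0&\text{if }\bar A_i\bar x=\bar b_i,\ p_i=0,\ \bar A_iu<0\end{array}\right\}$$ (where $Q(p)$ depends also on $u$). Then for all $u\in\mathbb{R}^n$ $$D^*\mathcal{F}(\bar x,\bar A,\bar b,\bar v)(u)\subset\bigcup_{p\in P(u),\ q\in Q(p)}\left\{\begin{pmatrix}\bar A^*q\\ q_1\bar x-p_1u\\ \vdots\\ q_m\bar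 x-p_mu\\ -q\end{pmatrix}\right\}.$$ If furthermore the active rows $\{\bar A_i\mid i\in I(\bar x,\bar A,\bar b)\}$ are linearly independent, then $$D^*\mathcal{F}(\bar x,\bar A,\bar b,\bar v)(u)=\bigcup_{q\in Q(\bar p)}\left\{\begin{pmatrix}\bar A^*q\\ q_1\bar x-\bar p_1u\\ \vdots\\ q_m\bar x-\bar p_mu\\ -q\end{pmatrix}\right\}\quad\text{if }u\in\bigcap_{\{i\mid\bar p_i>0\}}\bar A_i^\perp,$$ and $D^*\mathcal{F}(\bar x,\bar A,\bar b,\bar v)(u)=\emptyset$ otherwise, where $\bar p\in N_{\mathbb{R}^m_-}(\bar A\bar x-\bar b)$ is uniquely defined by $\bar A^*\bar p=-\bar v$.
   Context: $\mathbb{R}^m_-$ is the nonpositive orthant; $\bar A_i$ is the $i$-th row of $\bar A$ and $\bar A_i^\perp$ its orthogonal complement in $\mathbb{R}^n$. For a set $\Omega$ locally closed around $\bar x\in\Omega$, $N(\bar x;\Omega)=N_\Omega(\bar x)$ is the limiting (Mordukhovich) normal cone: $v\in N(\bar x;\Omega)$ iff there are $x_k\to\bar x$, $v_k\to v$ with $v_k\in\mathrm{cone}[x_k-\Pi(x_k;\Omega)]$, $\Pi$ the Euclidean projection; it is the usual normal cone for convex $\Omega$. The coderivative of a set-valued mapping $G$ at $(\bar x,\bar y)\in\mathrm{gph}\,G$ is $D^*G(\bar x,\bar y)(u):=\{v\mid(v,-u)\in N((\bar x,\bar y);\mathrm{gph}\,G)\}$. The mapping $\mathcal F$ is viewed as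 a mapping of $(x,A,b)\in\mathbb{R}^n\times\mathbb{R}^{nm}\times\mathbb{R}^m$ (empty-valued when $Ax\not\le b$), with $A$ identified with its rows in $(\mathbb{R}^n)^m$; elements of $D^*\mathcal F$ are written as column blocks for $x$, for the $m$ rows of $A$, and for $b$. $A^*$ is the transpose. Vectors $a_i$ are positively linearly independent if $\sum\alpha_ia_i=0$ with all $\alpha_i\ge0$ implies all $\alpha_i=0$. *)

(* Defs.v *)
From HB Require Import structures.
From mathcomp Require Import all_boot all_order all_algebra.
From mathcomp Require Import all_classical all_reals all_analysis.
Set Implicit Arguments.
Unset Strict Implicit.
Unset Printing Implicit Defensive.
Import Order.TTheory GRing.Theory Num.Theory.
Import numFieldNormedType.Exports.
Local Open Scope classical_set_scope.
Local Open Scope ring_scope.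

(* The library norm on matrices and on products is the max norm.  Euclidean
   projections need an inner product, which is added here on top of the
   library's normed-module structure; the last two axioms say that the Euclidean
   norm is equivalent to the library norm, so that the library's convergence is
   convergence for the Euclidean norm. *)
HB.mixin Record NormedModule_isEuclidean (R : realType) (V : Type)
    of NormedModule R V := {
  inner : V -> V -> R;
  innerC : forall x y, inner x y = inner y x;
  innerPl : forall a x y z, inner (a *: x + y) z = a * inner x z + inner y z;
  inner_ge0 : forall x, 0 <= inner x x;
  norm_le_inner : exists C : R, forall x, `|x| ^+ 2 <= C * inner x x;
  inner_le_norm : exists C : R, forall x, inner x x <= C * `|x| ^+ 2;
}.

#[short(type="euclideanType")]
HB.structure Definition Euclidean (R : realType) :=
  { V of NormedModule_isEuclidean R V & NormedModule R V }.

Section MatrixEuclidean.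
Variables (R : realType) (m n : nat).
Implicit Types A B C : 'M[R]_(m, n).

Definition mx_inner A B : R := \sum_i \sum_j A i j * B i j.

Lemma mx_innerC A B : mx_inner A B = mx_inner B A.
Proof. by apply: eq_bigr => i _; apply: eq_bigr => j _; rewrite mulrC. Qed.

Lemma mx_innerPl a A B C :
  mx_inner (a *: A + B) C = a * mx_inner A C + mx_inner B C.
Proof.
rewrite /mx_inner mulr_sumr -big_split; apply: eq_bigr => i _ /=.
rewrite mulr_sumr -big_split; apply: eq_bigr => j _ /=.
by rewrite !mxE mulrDl mulrA.
Qed.

Lemma mx_inner_ge0 A : 0 <= mx_inner A A.
Proof. by do 2![apply: sumr_ge0 => ? _]; rewrite -expr2 sqr_ge0. Qed.

Lemma mx_norm_le_inner : exists C : R, forall A, `|A| ^+ 2 <= C * mx_inner A A.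
Proof.
exists 1 => A; rewrite mul1r -[`|A|]/(mx_norm A).
have [->|nz] := eqVneq (mx_norm A) 0; first by rewrite expr0n mx_inner_ge0.
have [[i j] ->] := mx_norm_neq0 nz.
rewrite /mx_inner (bigD1 i) //= (bigD1 j) //= -addrA real_normK ?num_real //.
rewrite -expr2 lerDl addr_ge0 //.
  by apply: sumr_ge0 => ? _; rewrite -expr2 sqr_ge0.
by do 2![apply: sumr_ge0 => ? _]; rewrite -expr2 sqr_ge0.
Qed.

Lemma mx_inner_le_norm : exists C : R, forall A, mx_inner A A <= C * `|A| ^+ 2.
Proof.
exists (m%:R * n%:R) => A; rewrite -mulrA mulr_natl.
have coord i j : A i j * A i j <= `|A| ^+ 2.
  rewrite -expr2 -real_normK ?num_real // ler_pXn2r ?nnegrE //.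
  rewrite -[`|A|]/(mx_norm A) mx_normrE.
  exact: (le_bigmax _ (fun ij => `|A ij.1 ij.2|) (i, j)).
have -> : forall x : R, x *+ m = \sum_(i < m) x by move=> x; rewrite sumr_const card_ord.
rewrite mulr_natl; have -> : `|A| ^+ 2 *+ n = \sum_(j < n) `|A| ^+ 2.
  by rewrite sumr_const card_ord.
by do 2![apply: ler_sum => ? _].
Qed.

HB.instance Definition _ := NormedModule_isEuclidean.Build R 'M[R]_(m, n)
  mx_innerC mx_innerPl mx_inner_ge0 mx_norm_le_inner mx_inner_le_norm.
End MatrixEuclidean.

Section ProdEuclidean.
Variables (R : realType) (V W : euclideanType R).
Implicit Types x y z : V * W.

Definition prod_inner x y : R := inner x.1 y.1 + inner x.2 y.2.

Lemma prod_innerC x y : prod_inner x y = prod_inner y x.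
Proof. by rewrite /prod_inner innerC [inner x.2 _]innerC. Qed.

Lemma prod_innerPl a x y z :
  prod_inner (a *: x + y) z = a * prod_inner x z + prod_inner y z.
Proof. by rewrite /prod_inner /= !innerPl mulrDr addrACA. Qed.

Lemma prod_inner_ge0 x : 0 <= prod_inner x x.
Proof. by rewrite addr_ge0 ?inner_ge0. Qed.

Lemma prod_norm_le_inner :
  exists C : R, forall x, `|x| ^+ 2 <= C * prod_inner x x.
Proof.
have [C1 h1] := @norm_le_inner R V; have [C2 h2] := @norm_le_inner R W.
exists (`|C1| + `|C2|) => -[x y]; rewrite /prod_inner /= prod_normE /=.
have x0 := inner_ge0 x; have y0 := inner_ge0 y.
rewrite mulrDr !mulrDl; case: (leP `|x| `|y|) => _.
  apply: (le_trans (h2 y)); apply: (@le_trans _ _ (`|C2| * inner y y)).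
    by rewrite ler_wpM2r // ler_norm.
  by rewrite addrA lerDr !addr_ge0 ?mulr_ge0.
apply: (le_trans (h1 x)); apply: (@le_trans _ _ (`|C1| * inner x x)).
  by rewrite ler_wpM2r // ler_norm.
by rewrite -addrA lerDl !addr_ge0 ?mulr_ge0.
Qed.

Lemma prod_inner_le_norm :
  exists C : R, forall x, prod_inner x x <= C * `|x| ^+ 2.
Proof.
have [C1 h1] := @inner_le_norm R V; have [C2 h2] := @inner_le_norm R W.
exists (`|C1| + `|C2|) => -[x y]; rewrite /prod_inner /= prod_normE /= mulrDl.
apply: lerD.
  apply: (le_trans (h1 x)); apply: (@le_trans _ _ (`|C1| * `|x| ^+ 2)).
    by rewrite ler_wpM2r ?exprn_ge0 ?ler_norm.
  by rewrite ler_wpM2l // ler_pXn2r ?nnegrE ?le_max ?lexx ?normr_ge0.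
apply: (le_trans (h2 y)); apply: (@le_trans _ _ (`|C2| * `|y| ^+ 2)).
  by rewrite ler_wpM2r ?exprn_ge0 ?ler_norm.
by rewrite ler_wpM2l // ler_pXn2r ?nnegrE ?le_max ?lexx ?normr_ge0 ?orbT.
Qed.

HB.instance Definition _ := NormedModule_isEuclidean.Build R (V * W)%type
  prod_innerC prod_innerPl prod_inner_ge0 prod_norm_le_inner
  prod_inner_le_norm.
End ProdEuclidean.

Section VariationalAnalysis.
Variable R : realType.

Definition enorm (V : euclideanType R) (x : V) : R := Num.sqrt (inner x x).

(* Conic hull, without convexification. *)
Definition cone (V : lmodType R) (S : set V) : set V :=
  [set v | exists2 a : R, 0 <= a & exists2 s, S s & v = a *: s].

Definition eproj (V : euclideanType R) (x : V) (Om : set V) : set V :=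
  [set w | Om w /\ forall z, Om z -> enorm (x - w) <= enorm (x - z)].

(* The limiting (Mordukhovich) normal cone; it is empty when the base point is
   not in the set, so that [Fmap] below is empty-valued where [A x <= b] fails. *)
Definition normal_cone (V : euclideanType R) (x : V) (Om : set V) : set V :=
  [set v | Om x /\ exists x_ v_ : nat -> V,
    [/\ x_ @ \oo --> x, v_ @ \oo --> v &
        forall k, cone [set x_ k - w | w in eproj (x_ k) Om] (v_ k)]].

Definition gph (V W : Type) (G : V -> set W) : set (V * W) :=
  [set z | G z.1 z.2].

Definition coderivative (V W : euclideanType R) (G : V -> set W)
    (x : V) (y : W) (u : W) : set V :=
  [set v | normal_cone (x, y) (gph G) (v, - u)].

Definition pos_lin_indep (V : lmodType R) (I : finType) (P : pred I)
    (a : I -> V) : Prop :=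
  forall al : I -> R, (forall i, P i -> 0 <= al i) ->
    \sum_(i | P i) al i *: a i = 0 -> forall i, P i -> al i = 0.

End VariationalAnalysis.

Section Polyhedron.
Variables (R : realType) (m n : nat).
Implicit Types (A : 'M[R]_(m, n)) (b p q : 'cV[R]_m) (x u v : 'cV[R]_n).

Definition neg_orthant : set 'cV[R]_m := [set y | forall i, y i 0 <= 0].

Definition polyhedron A b : set 'cV[R]_n :=
  [set x | forall i, (A *m x) i 0 <= b i 0].

Definition Fmap (w : 'cV[R]_n * 'M[R]_(m, n) * 'cV[R]_m) : set 'cV[R]_n :=
  let: (x, A, b) := w in [set - v | v in normal_cone x (polyhedron A b)].

Definition active x A b : {set 'I_m} :=
  [set i | (A *m x) i 0 == b i 0].

Definition row_perp A (i : 'I_m) : set 'cV[R]_n :=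
  [set u | (A *m u) i 0 = 0].

Definition perp_pos A p : set 'cV[R]_n :=
  \bigcap_(i in [set i | 0 < p i 0]) row_perp A i.

Definition Pset x A b v u : set 'cV[R]_m :=
  [set p | [/\ normal_cone (A *m x - b) neg_orthant p,
               A^T *m p = - v & perp_pos A p u]].

Definition Qset x A b u p : set 'cV[R]_m :=
  [set q | forall i,
    ((A *m x) i 0 < b i 0 \/
       [/\ (A *m x) i 0 = b i 0, p i 0 = 0 & 0 < (A *m u) i 0] ->
     q i 0 = 0) /\
    ([/\ (A *m x) i 0 = b i 0, p i 0 = 0 & (A *m u) i 0 < 0] ->
     0 <= q i 0)].

Definition cod_elt x A u p q : 'cV[R]_n * 'M[R]_(m, n) * 'cV[R]_m :=
  (A^T *m q, \matrix_(i < m) (q i 0 *: x - p i 0 *: u)^T, - q).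

End Polyhedron.

(* Main.v *)
(* Limiting normals are limits of proximal normals, and by Farkas' lemma the graph of
   [Fmap] is { (x, A, b, - A^T p) | p >= 0, A x <= b, p complementary to A x - b }.
   Moving x, A, b, p along lines that respect complementarity shows that a proximal
   normal at such a point is [cod_elt x A u p q] together with sign conditions on q and
   A u.  Positive linear independence gives a direction d with A_i d >= 1 on the active
   rows, hence bounds the multipliers p along the approximating sequence, and the sign
   conditions survive in the limit along an ultrafilter.  Conversely, linear
   independence makes p a Lipschitz function of the graph point, so that the sign
   conditions imply proximal normality; every q in [Qset] is reached by slackening the
   rows with A_i u > 0 and activating the multipliers of those with A_i u = 0. *)
Require Import Defs.
From mathcomp Require Import all_boot all_order all_algebra.
From mathcomp Require Import all_classical all_reals all_analysis.
From mathcomp Require Import ring lra.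
Import Order.TTheory GRing.Theory Num.Theory.
Import numFieldNormedType.Exports.
Local Open Scope classical_set_scope.
Local Open Scope ring_scope.

(** * Proximal normals *)

Section InnerTheory.
Context {R : realType} {V : euclideanType R}.
Implicit Types x y z : V.

Lemma inner0l z : inner (0 : V) z = 0.
Proof. by have := innerPl 1 (0 : V) 0 z; rewrite scaler0 addr0 mul1r; lra. Qed.

Lemma innerDl x y z : inner (x + y) z = inner x z + inner y z.
Proof. by rewrite -{1}[x]scale1r innerPl mul1r. Qed.

Lemma innerZl a x z : inner (a *: x) z = a * inner x z.
Proof. by rewrite -[a *: x]addr0 innerPl inner0l addr0. Qed.

Lemma innerNl x z : inner (- x) z = - inner x z.
Proof. by rewrite -scaleN1r innerZl mulN1r. Qed.

Lemma inner0r z : inner z (0 : V) = 0.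
Proof. by rewrite innerC inner0l. Qed.

Lemma innerDr x y z : inner z (x + y) = inner z x + inner z y.
Proof. by rewrite ![inner z _]innerC innerDl. Qed.

Lemma innerZr a x z : inner z (a *: x) = a * inner z x.
Proof. by rewrite ![inner z _]innerC innerZl. Qed.

Lemma innerNr x z : inner z (- x) = - inner z x.
Proof. by rewrite ![inner z _]innerC innerNl. Qed.

Lemma le_enorm x y : (enorm x <= enorm y) = (inner x x <= inner y y).
Proof. by rewrite /enorm ler_sqrt // inner_ge0. Qed.

Lemma norm_le_innerW : exists2 C : R, 0 < C & forall x, `|x| ^+ 2 <= C * inner x x.
Proof.
have [C hC] := @norm_le_inner R V; exists (`|C| + 1); first by rewrite ltr_wpDl.
move=> x; apply: le_trans (hC x) _; rewrite ler_wpM2r ?inner_ge0 //.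
by apply: le_trans (ler_norm _) _; rewrite lerDl.
Qed.

Lemma inner_le_normW : exists2 C : R, 0 < C & forall x, inner x x <= C * `|x| ^+ 2.
Proof.
have [C hC] := @inner_le_norm R V; exists (`|C| + 1); first by rewrite ltr_wpDl.
move=> x; apply: le_trans (hC x) _; rewrite ler_wpM2r ?sqr_ge0 //.
by apply: le_trans (ler_norm _) _; rewrite lerDl.
Qed.

(** For projections [w_ k] of [x_ k] onto a set containing [x], the second hypothesis is minimality
    tested at [x]. Equivalence of the norms then forces convergence in the library norm. *)
Lemma inner_sub_cvg0 (x_ w_ : nat -> V) x :
  x_ @ \oo --> x -> (forall k, inner (x_ k - w_ k) (x_ k - w_ k) <=
                               inner (x_ k - x) (x_ k - x)) ->
  w_ @ \oo --> x.
Proof.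
move=> cx le_w.
have [C C0 hC] := norm_le_innerW; have [D D0 hD] := inner_le_normW.
have K1 : 0 <= C * D by rewrite mulr_ge0 ?ltW.
(* The squares compare with factor [C * D], which is at most [(1 + C * D) ^+ 2]; this avoids a
   square root. *)
have le_norm k : `|x_ k - w_ k| <= (1 + C * D) * `|x - x_ k|.
  rewrite -(@ler_pXn2r _ 2) ?nnegrE ?mulr_ge0 ?addr_ge0 //.
  apply: (le_trans (hC _)); apply: (@le_trans _ _ (C * D * `|x - x_ k| ^+ 2)).
    rewrite -mulrA; apply: ler_wpM2l (ltW C0) _ _ _; apply: le_trans (le_w k) _.
    by rewrite distrC; apply: hD.
  rewrite exprMn ler_wpM2r ?sqr_ge0 //; nra.
apply/cvgrPdist_lt => e e0.
have K2 : 0 < 2 + C * D by lra.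
have /cvgrPdist_lt/(_ (e / (2 + C * D)) (divr_gt0 e0 K2)) := cx.
apply: filterS => k; rewrite ltr_pdivlMr // => hk.
have -> : x - w_ k = (x - x_ k) + (x_ k - w_ k) by rewrite addrA subrK.
apply: le_lt_trans (ler_normD _ _) _.
apply: le_lt_trans hk; have := le_norm k; lra.
Qed.

End InnerTheory.

Section ProximalNormals.
Context {R : realType} {V : euclideanType R}.
Implicit Types (x v z : V) (Om : set V).

(** The quadratic inequality replaces projections, so that normals can be tested along lines inside
    [Om]. *)
Definition proximal_normal x Om v := Om x /\
  exists s : R, forall z, Om z -> inner v (z - x) <= s * inner (z - x) (z - x).

(** Expanding the squared distances from [x] to [z] and to [w], minimality says that twice the
    product of [x - w] and [z - w] is at most the square of [z - w]. Hence [s = a / 2] works. *)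
Lemma proximal_normal_eproj x w Om v :
  eproj x Om w -> (exists2 a : R, 0 <= a & v = a *: (x - w)) ->
  proximal_normal w Om v.
Proof.
move=> [Omw min_w] [a a0 ->]; split=> //; exists (a / 2) => z Omz.
have := min_w _ Omz; rewrite le_enorm.
have -> : x - z = (x - w) - (z - w) by rewrite opprB addrA subrK.
move: (x - w) (z - w) => p d.
rewrite innerZl !(innerDl, innerDr, innerNl, innerNr) (innerC d p) => h.
rewrite -mulrA ler_wpM2l //; lra.
Qed.

(** With [d = z - w], the squared distances of [w + t *: v] to [z] and to [w] differ by
    [inner d d - 2 * t * inner v d], which is at least [(1 - 2 * t * s) * inner d d]. *)
Lemma eproj_proximal w Om v (s t : R) : Om w ->
  (forall z, Om z -> inner v (z - w) <= s * inner (z - w) (z - w)) ->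
  0 <= t -> t * s <= 1 / 2 -> eproj (w + t *: v) Om w.
Proof.
move=> Omw hs t0 ts; split=> // z Omz; rewrite le_enorm.
have -> : w + t *: v - w = t *: v by rewrite addrAC subrr add0r.
have -> : w + t *: v - z = t *: v - (z - w) by rewrite opprB addrCA addrA.
have := hs _ Omz; move: (z - w) => d hd.
rewrite !(innerDl, innerDr, innerNl, innerNr, innerZl, innerZr) (innerC d v).
have d0 := inner_ge0 d.
have : t * inner v d <= 1 / 2 * inner d d.
  apply: le_trans (ler_wpM2l t0 hd) _; rewrite mulrA; exact: ler_wpM2r.
lra.
Qed.

(** From left to right the projections serve as base points. Conversely each base point is pushed
    out along its normal, so little that it remains its own projection. *)
Lemma normal_coneP x Om v : normal_cone x Om v <->
  Om x /\ exists w_ v_ : nat -> V, [/\ w_ @ \oo --> x, v_ @ \oo --> v &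
    forall k, proximal_normal (w_ k) Om (v_ k)].
Proof.
split=> [[Omx [x_ [v_ [cx cv hv]]]]|[Omx [w_ [v_ [cw cv hv]]]]]; split=> //.
  have wP k : exists w, eproj (x_ k) Om w /\
      exists2 a : R, 0 <= a & v_ k = a *: (x_ k - w).
    by have [a a0 [_ [w hw <-] ->]] := hv k; exists w; split=> //; exists a.
  have [w_ w_P] := choice wP; exists w_, v_; split=> //.
    apply: inner_sub_cvg0 cx _ => k; have [[_ hw] _] := w_P k.
    by rewrite -le_enorm; apply: hw.
  by move=> k; have [hw ha] := w_P k; apply: proximal_normal_eproj hw ha.
have [s_ s_P] := choice (fun k => (hv k).2).
(* The numerator makes [t_] tend to 0, the denominator ensures [t_ k * s_ k <= 1 / 2] as
   [eproj_proximal] requires. *)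
pose t_ k : R := harmonic k / (2 * (1 + `|s_ k|)).
have D1 k : 0 < 2 * (1 + `|s_ k|) by rewrite mulr_gt0 // ltr_pwDl.
have t0 k : 0 < t_ k by rewrite divr_gt0 // harmonic_gt0.
have har1 k : harmonic k <= 1 :> R by rewrite /harmonic /= invf_le1 ?ler1n.
have th k : t_ k <= harmonic k.
  rewrite /t_ ler_pdivrMr // ler_peMr ?harmonic_ge0 //.
  have := normr_ge0 (s_ k); lra.
have ts k : t_ k * s_ k <= 1 / 2.
  rewrite /t_ mulrAC ler_pdivrMr //; have := har1 k.
  have := harmonic_ge0 k : 0 <= _ :> R; have := ler_norm (s_ k).
  move: (harmonic k) (s_ k) => h s; have := normr_ge0 s; nra.
have ct : t_ @ \oo --> (0 : R).
  apply: squeeze_cvgr (cvg_cst 0) (@cvg_harmonic R).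
  by apply: nearW => k; rewrite th ltW.
exists (fun k => w_ k + t_ k *: v_ k), v_; split=> //.
  by rewrite -[x]addr0 -(scale0r v); apply: cvgD => //; apply: cvgZ.
move=> k; exists (t_ k)^-1; first by rewrite invr_ge0 ltW.
exists (t_ k *: v_ k); last by rewrite scalerA mulVf ?scale1r // gt_eqF.
exists (w_ k); last by rewrite addrAC subrr add0r.
exact: eproj_proximal (hv k).1 (s_P k) (ltW (t0 k)) (ts k).
Qed.

(** Along the segment the left side of the proximal inequality is linear in [t] and the right side
    quadratic; divide by [t] and let it tend to 0. *)
Lemma proximal_normal_tangent x Om v d (e : R) : 0 < e ->
  (forall t, 0 < t -> t <= e -> Om (x + t *: d)) ->
  proximal_normal x Om v -> inner v d <= 0.
Proof.
move=> e0 Omd [_ [s hs]].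
have key t : 0 < t -> t <= e -> inner v d <= t * (`|s| * inner d d).
  move=> t0 te; have := hs _ (Omd t t0 te).
  have -> : x + t *: d - x = t *: d by rewrite addrAC subrr add0r.
  rewrite !(innerZl, innerZr) => h; rewrite -(ler_pM2l t0); apply: le_trans h _.
  have -> : s * (t * (t * inner d d)) = t * (t * (s * inner d d)) by ring.
  by rewrite !ler_pM2l // ler_wpM2r ?inner_ge0 // ler_norm.
have K0 : 0 <= `|s| * inner d d by rewrite mulr_ge0 ?inner_ge0.
rewrite leNgt; apply/negP => vd0.
(* For this [t] the bound in [key] is less than half of [inner v d], a contradiction. *)
pose t := Num.min e (inner v d / (2 * (1 + `|s| * inner d d))).
have D0 : 0 < 2 * (1 + `|s| * inner d d) by lra.
have t0 : 0 < t by rewrite lt_min e0 divr_gt0.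
have /key : t <= e by rewrite ge_min lexx.
move=> /(_ t0).
have : t <= inner v d / (2 * (1 + `|s| * inner d d)) by rewrite ge_min lexx orbT.
rewrite ler_pdivlMr //; nra.
Qed.

(* Away from [x] the quadratic bound holds for every [v]. *)
Lemma proximal_normal_near x Om v : Om x ->
  (exists s : R, \forall z \near x, Om z ->
     inner v (z - x) <= s * inner (z - x) (z - x)) ->
  proximal_normal x Om v.
Proof.
move=> Omx [s /nbhs_ballP[e /= e0 hs]]; split=> //.
have [C C0 hC] := @norm_le_innerW R V.
pose D := e ^+ 2 / C.
have D0 : 0 < D by rewrite divr_gt0 // exprn_gt0.
(* The first summand serves the points near [x]. At far points [inner d d >= D], and twice
   [inner v d] is at most [inner v v + inner d d], which gives the second. *)
exists (`|s| + (inner v v / D + 1) / 2) => z Omz.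
have dd0 := inner_ge0 (z - x); have vv0 := inner_ge0 v.
have vD0 : 0 <= inner v v / D by rewrite divr_ge0 // ltW.
have s0 := normr_ge0 s.
have [near_z|far_z] := ltP (inner (z - x) (z - x)) D.
  have bz : ball x e z.
    rewrite -ball_normE /ball_ /= distrC -(@ltr_pXn2r _ 2) ?nnegrE ?(ltW e0) //.
    apply: le_lt_trans (hC _) _.
    by rewrite mulrC -ltr_pdivlMr.
  apply: le_trans (hs _ bz Omz) _; rewrite ler_wpM2r //.
  have := ler_norm s; lra.
have := inner_ge0 (v - (z - x)); move: (z - x) dd0 far_z => d dd0 far_d.
rewrite !(innerDl, innerDr, innerNl, innerNr) (innerC d v) => h.
have : inner v v <= inner v v / D * inner d d.
  by rewrite mulrAC ler_pdivlMr // ler_wpM2l.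
nra.
Qed.

End ProximalNormals.

(** * Farkas and Gordan alternatives *)

(* Bartl's induction: if [c] is not nonpositive on the cone cut out by the other
   functionals, pick [y] there with [c y > 0], and project along [y] to the kernel
   of the remaining functional. *)
Lemma farkas {R : realFieldType} {V : lmodType R} (m : nat) (a : 'I_m -> V -> R)
    (c : V -> R) :
  (forall i, scalar (a i)) -> scalar c ->
  (forall x, (forall i, a i x <= 0) -> c x <= 0) ->
  exists2 p : 'I_m -> R, (forall i, 0 <= p i) & forall x, c x = \sum_i p i * a i x.
Proof.
elim: m a c => [|m IH] a c lin_a lin_c hc.
  exists (fun=> 0) => // x; rewrite big_ord0; apply/eqP; rewrite eq_le hc /=; last by case.
  have := hc (- x); have := lin_c (- 1) x 0; rewrite scaleN1r addr0 => ->.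
  have := lin_c (-1) 0 0; rewrite scaler0 addr0 => c0.
  move=> /(_ _); have -> : c 0 = 0 by lra.
  by rewrite mulN1r addr0 oppr_le0; apply; case.
pose a' i := a (lift ord0 i).
have [[y [a'y cy]]|no_y] := pselect (exists y, (forall i, a' i y <= 0) /\ 0 < c y);
  last first.
  have [|p p0 hp] := IH a' c (fun i => lin_a _) lin_c.
    by move=> x hx; rewrite leNgt; apply/negP => cx; apply: no_y; exists x.
  exists (fun i => oapp p 0 (unlift ord0 i)).
    by move=> i; case: unliftP => //=.
  move=> x; rewrite big_ord_recl unlift_none mul0r add0r hp.
  by apply: eq_bigr => i _; rewrite liftK.
have ay : 0 < a ord0 y.
  rewrite ltNge; apply/negP => ay; have : c y <= 0; last by rewrite leNgt cy.
  by apply: hc => i; case: (unliftP ord0 i) => [j|] ->; [apply: a'y|].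
pose b f (x : V) : R := f x - f y / a ord0 y * a ord0 x.
have lin_b f : scalar f -> scalar (b f).
  move=> lf s x z; rewrite /b lf (lin_a ord0) /=; ring.
have bE f x : scalar f -> f (x - (a ord0 x / a ord0 y) *: y) = b f x.
  move=> lf; rewrite addrC -scaleNr lf /= /b; ring.
have [|p p0 hp] := IH (fun i => b (a' i)) (b c) (fun i => lin_b _ (lin_a _)) (lin_b _ lin_c).
  move=> x hx; rewrite -(bE c) //; apply: hc => i.
  case: (unliftP ord0 i) => [j|] ->; rewrite bE //; last first.
    by rewrite /b divff ?gt_eqF // mul1r subrr.
  exact: hx.
(* This is the coefficient of [a ord0] once the projected identity is written out. It is nonnegative
   because [c y > 0] and each [a' i y <= 0]. *)
pose r := (c y - \sum_i p i * a' i y) / a ord0 y.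
have r0 : 0 <= r.
  rewrite divr_ge0 ?(ltW ay) // subr_ge0; apply: le_trans (ltW cy).
  by apply: sumr_le0 => i _; rewrite mulr_ge0_le0.
exists (fun i => oapp p r (unlift ord0 i)).
  by move=> i; case: unliftP => //=.
move=> x; rewrite big_ord_recl unlift_none /=.
under [X in _ = _ + X]eq_bigr do rewrite liftK /=.
have : b c x = \sum_i p i * a' i x - (\sum_i p i * a' i y) / a ord0 y * a ord0 x.
  rewrite hp !mulr_suml -sumrB; apply: eq_bigr => i _.
  by rewrite /b mulrBr !mulrA.
rewrite /r {1}/b /a'; move: (\sum_i _) (\sum_i _) => S1 S2 h.
rewrite !mulrBl; lra.
Qed.

(** Homogenize: a pair [(x, t)] with [t > 0] and all [a i x + t <= 0] would give the direction
    [- x / t]. If there is none, Farkas yields nonnegative weights of sum 1 on [I] that annihilate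
    the [a i], against positive independence. *)
Lemma gordan {R : realFieldType} {V : lmodType R} (m : nat) (I : pred 'I_m)
    (a : 'I_m -> V -> R) :
  (forall i, scalar (a i)) ->
  (forall p : 'I_m -> R, (forall i, I i -> 0 <= p i) ->
    (forall x, \sum_(i | I i) p i * a i x = 0) -> forall i, I i -> p i = 0) ->
  exists d, forall i, I i -> 1 <= a i d.
Proof.
move=> lin_a pli; apply: contrapT => no_d.
pose f i (z : V * R^o) : R := if I i then a i z.1 + z.2 else 0.
have lin_f i : scalar (f i).
  move=> s x z; rewrite /f; case: ifP => _; last by ring.
  by rewrite /= lin_a /=; rewrite -[s *: x.2]/(s * x.2); ring.
have [] := @farkas R _ m f (fun z => z.2) lin_f.
- by move=> s x z.
- move=> [x t] /= hx; rewrite leNgt; apply/negP => t0; apply: no_d.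
  exists ((- t^-1) *: x + 0) => i Ii; rewrite lin_a /=.
  have := lin_a i (-1) 0 0; rewrite scaler0 addr0 => a0.
  have -> : a i 0 = 0 by lra.
  have := hx i; rewrite /f Ii /= addr0 mulNr -mulrN mulrC ler_pdivlMr // mul1r; lra.
move=> p p0 hp.
have h0 x t : t = \sum_(i | I i) p i * (a i x + t).
  have /= := hp (x, t) => {1}->.
  by rewrite [RHS]big_mkcond; apply: eq_bigr => i _; rewrite /f /=; case: ifP; rewrite ?mulr0.
have pI := pli p (fun i _ => p0 i).
have := h0 0 1; rewrite big1 => [/eqP|i Ii]; first by rewrite oner_eq0.
rewrite pI ?mul0r // => x; rewrite [RHS](h0 x).
by apply: eq_bigr => j _; rewrite addr0.
Qed.

(** * Normal cones of polyhedra *)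

Section MatrixLimits.
Context {R : realType} {T : Type} {F : set_system T} {FF : Filter F}.

Lemma cvg_mx {m n} {f : T -> 'M[R]_(m, n)} {l : 'M[R]_(m, n)} :
  (forall i j, f t i j @[t --> F] --> l i j) -> f @ F --> l.
Proof.
move=> cf; apply/cvg_ballP => e e0.
have : \forall t \near F, forall i j, ball (l i j) e (f t i j).
  apply: filter_forall => i; apply: filter_forall => j.
  by have /cvg_ballP/(_ e e0) := cf i j.
by apply: filterS => t ht; split.
Qed.

Lemma cvg_coord {m n} {f : T -> 'M[R]_(m, n)} {l : 'M[R]_(m, n)} :
  f @ F --> l -> forall i j, f t i j @[t --> F] --> l i j.
Proof. by move=> cf i j; exact: (cvg_comp _ _ cf (@coord_continuous _ _ _ i j l)). Qed.

Lemma cvg_mulmx {m n k} {f : T -> 'M[R]_(m, n)} {g : T -> 'M[R]_(n, k)}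
    {a : 'M[R]_(m, n)} {b : 'M[R]_(n, k)} :
  f @ F --> a -> g @ F --> b -> f t *m g t @[t --> F] --> a *m b.
Proof.
move=> cf cg; apply: cvg_mx => i j; rewrite mxE; under eq_fun do rewrite mxE.
apply: (@cvg_big _ _ +%R 0 xpredT); first exact: add_continuous.
by move=> l _; apply: cvgM; apply: cvg_coord.
Qed.

Lemma cvg_trmx {m n} {f : T -> 'M[R]_(m, n)} {a : 'M[R]_(m, n)} :
  f @ F --> a -> (f t)^T @[t --> F] --> a^T.
Proof.
move=> cf; apply: cvg_mx => i j; rewrite mxE; under eq_fun do rewrite mxE.
exact: cvg_coord.
Qed.

Lemma cvg_inner_mx {m n} {f g : T -> 'M[R]_(m, n)} {a b : 'M[R]_(m, n)} :
  f @ F --> a -> g @ F --> b -> inner (f t) (g t) @[t --> F] --> inner a b.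
Proof.
move=> cf cg; do 2![apply: (@cvg_big _ _ +%R 0 xpredT); first exact: add_continuous; move=> ? _].
by apply: cvgM; apply: cvg_coord.
Qed.

End MatrixLimits.

Section Polyhedra.
Context {R : realType}.

Lemma subcvE {m} (x y : 'cV[R]_m) i : (x - y) i 0 = x i 0 - y i 0.
Proof. by rewrite !mxE. Qed.

Lemma linecvE {m} (x y : 'cV[R]_m) t i : (x + t *: y) i 0 = x i 0 + t * y i 0.
Proof. by rewrite !mxE. Qed.

Lemma mulmx_lineE {m n} (A : 'M[R]_(m, n)) (x y : 'cV[R]_n) t i :
  (A *m (x + t *: y)) i 0 = (A *m x) i 0 + t * (A *m y) i 0.
Proof. by rewrite mulmxDr -scalemxAr mxE [X in _ + X]mxE. Qed.

Lemma inner_cV {n} (x y : 'cV[R]_n) : inner x y = \sum_i x i 0 * y i 0.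
Proof. by apply: eq_bigr => i _; rewrite big_ord1. Qed.

Lemma inner_trmx_mul {m n} (A : 'M[R]_(m, n)) (p : 'cV[R]_m) (x : 'cV[R]_n) :
  inner (A^T *m p) x = inner p (A *m x).
Proof.
rewrite !inner_cV; under eq_bigr do rewrite mxE mulr_suml.
rewrite exchange_big; apply: eq_bigr => i _ /=.
rewrite mxE mulr_sumr; apply: eq_bigr => j _; rewrite mxE; ring.
Qed.

Lemma inner_outer {m n} (B : 'M[R]_(m, n)) (p : 'cV[R]_m) (x : 'cV[R]_n) :
  inner (p *m x^T) B = inner p (B *m x).
Proof.
rewrite inner_cV; apply: eq_bigr => i _.
rewrite mxE mulr_sumr; apply: eq_bigr => j _; rewrite mxE big_ord1 mxE; ring.
Qed.

Lemma inner_eq0 {m n} (A : 'M[R]_(m, n)) : inner A A <= 0 -> A = 0.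
Proof.
move=> le0; apply/eqP; rewrite -normr_le0.
have [C C0 hC] := @norm_le_innerW R 'M[R]_(m, n).
have : `|A| ^+ 2 <= 0.
  apply: le_trans (hC A) _; rewrite pmulr_rle0 //.
by rewrite -[0 in X in X -> _](expr0n R 2) ler_pXn2r ?nnegrE.
Qed.

(** The Karush-Kuhn-Tucker conditions: feasibility, sign and complementarity. By
    [normal_cone_multiplierP] they describe the normals to the nonpositive orthant at
    [A *m x - b]. *)
Definition multiplier {m n} (x : 'cV[R]_n) (A : 'M[R]_(m, n)) (b p : 'cV[R]_m) :=
  forall i, [/\ (A *m x) i 0 <= b i 0, 0 <= p i 0 &
                p i 0 * ((A *m x) i 0 - b i 0) = 0].

(** By convexity the segment from [w_ k] to [z] stays in the polyhedron, so each proximal normal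
    satisfies the inequality, which passes to the limit. *)
Lemma normal_cone_polyhedron_le {m n} (x v z : 'cV[R]_n) (A : 'M[R]_(m, n)) b :
  normal_cone x (polyhedron A b) v -> polyhedron A b z -> inner v (z - x) <= 0.
Proof.
move=> /normal_coneP[_ [w_ [v_ [cw cv hv]]]] Oz.
apply: (@cvgr_to_le _ \oo _ _ (fun k => inner (v_ k) (z - w_ k))).
  by apply: cvg_inner_mx cv _; apply: cvgB cw; apply: cvg_cst.
apply: nearW => k; apply: proximal_normal_tangent (hv k) => // t t0 t1 i.
have := (hv k).1 i; have := Oz i; rewrite mulmx_lineE mulmxBr.
rewrite subcvE /=.
move: ((A *m z) i 0) ((A *m w_ k) i 0) => r s; nra.
Qed.

Lemma normal_cone_polyhedronP {m n} (x v : 'cV[R]_n) (A : 'M[R]_(m, n)) b :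
  normal_cone x (polyhedron A b) v <->
  polyhedron A b x /\ exists2 p, multiplier x A b p & v = A^T *m p.
Proof.
split=> [hv|[Ox [p hp ->]]]; last first.
  apply/normal_coneP; split=> //; exists (fun=> x), (fun=> A^T *m p).
  split; [exact: cvg_cst|exact: cvg_cst|move=> _; split=> //].
  exists 0 => z Oz; rewrite mul0r inner_trmx_mul inner_cV; apply: sumr_le0 => i _.
  have [_ p0 pc] := hp i; have := Oz i; rewrite mulmxBr subcvE => hz.
  have -> : p i 0 * ((A *m z) i 0 - (A *m x) i 0) = p i 0 * ((A *m z) i 0 - b i 0).
    by rewrite -[LHS]addr0 -pc; ring.
  by rewrite mulr_ge0_le0 // subr_le0.
have Ox : polyhedron A b x by case: hv.
split=> //.
(* Inactive rows become zero functionals, so that Farkas runs over all of ['I_m]. A direction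
   nonpositive on the active rows is feasible for a short step. *)
pose f i (h : 'cV[R]_n) := if i \in active x A b then (A *m h) i 0 else 0.
have [||h hh|p p0 hp] := @farkas R _ m f (fun h => inner v h).
- move=> i s y z; rewrite /f; case: ifP => _; last by rewrite mulr0 addr0.
  by rewrite [s *: y + z]addrC mulmx_lineE addrC.
- by move=> s y z; rewrite innerDr innerZr.
- have [e /= e0 he] : exists2 e : R, 0 < e & polyhedron A b (x + e *: h).
    have : \forall e \near (0 : R)^'+, forall i, (A *m (x + e *: h)) i 0 <= b i 0.
      apply: filter_forall => i; have := hh i; rewrite /f inE.
      have [<- Ah0|ne _] := eqVneq.
        near=> e; rewrite mulmx_lineE gerDl.
        by rewrite mulr_ge0_le0.
      have lt_i : 0 < b i 0 - (A *m x) i 0 by rewrite subr_gt0 lt_neqAle ne Ox.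
      near=> e; rewrite mulmx_lineE.
      have : e <= (b i 0 - (A *m x) i 0) / (1 + `|(A *m h) i 0|).
        by near: e; apply: nbhs_right_le; rewrite divr_gt0 // ltr_pwDl.
      rewrite ler_pdivlMr ?ltr_pwDl // => he.
      have e0 : 0 <= e by [].
      have := ler_wpM2l e0 (ler_norm ((A *m h) i 0)); lra.
    move=> he; have [e [e0 ?]] := filter_ex (filterI (nbhs_right_gt (0 : R)) he).
    by exists e.
  have := normal_cone_polyhedron_le _ _ _ _ _ hv he.
  by rewrite addrAC subrr add0r innerZr pmulr_rle0.
pose q : 'cV[R]_m := \col_i (if i \in active x A b then p i else 0).
have qE h : inner v h = inner q (A *m h).
  rewrite hp inner_cV; apply: eq_bigr => i _; rewrite /f [q i 0]mxE.
  by case: ifP => _; rewrite ?mulr0 ?mul0r.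
exists q.
  move=> i; split; [exact: Ox|by rewrite mxE; case: ifP|].
  rewrite [q i 0]mxE inE; case: eqVneq => [->|_]; last by rewrite mul0r.
  by rewrite subrr mulr0.
apply/eqP; rewrite -subr_eq0; apply/eqP; apply: inner_eq0.
by rewrite innerDl innerNl inner_trmx_mul qE subrr.
Unshelve. all: by end_near.
Qed.

Lemma FmapP {m n} (x v : 'cV[R]_n) (A : 'M[R]_(m, n)) b :
  Fmap (x, A, b) v <->
  polyhedron A b x /\ exists2 p, multiplier x A b p & v = - (A^T *m p).
Proof.
split=> [[w /normal_cone_polyhedronP[Ox [p hp ->]] <-]|[Ox [p hp ->]]].
  by split=> //; exists p.
by exists (A^T *m p) => //; apply/normal_cone_polyhedronP; split=> //; exists p.
Qed.

(** The orthant is the polyhedron of the identity matrix with right-hand side 0. *)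
Lemma normal_cone_neg_orthantP {m} (y p : 'cV[R]_m) :
  normal_cone y (@neg_orthant R m) p <->
  forall i, [/\ y i 0 <= 0, 0 <= p i 0 & p i 0 * y i 0 = 0].
Proof.
have -> : @neg_orthant R m = polyhedron 1%:M (0 : 'cV[R]_m).
  by apply/seteqP; split=> z hz i; have := hz i; rewrite /= mul1mx mxE.
split=> [/normal_cone_polyhedronP[_ [q hq ->]]|hp].
  by move=> i; have := hq i; rewrite trmx1 !mul1mx [(0 : 'cV_m) i 0]mxE subr0.
apply/normal_cone_polyhedronP; split.
  by move=> i; rewrite mul1mx mxE; case: (hp i).
exists p; last by rewrite trmx1 mul1mx.
by move=> i; rewrite mul1mx [(0 : 'cV_m) i 0]mxE subr0.
Qed.

Lemma normal_cone_multiplierP {m n} (x : 'cV[R]_n) (A : 'M[R]_(m, n)) (b p : 'cV[R]_m) :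
  normal_cone (A *m x - b) (@neg_orthant R m) p <-> multiplier x A b p.
Proof.
split=> [/normal_cone_neg_orthantP|] hp.
  by move=> i; have := hp i; rewrite subcvE subr_le0.
by apply/normal_cone_neg_orthantP => i; have := hp i; rewrite subcvE subr_le0.
Qed.

End Polyhedra.

(** * Proximal normals to the graph *)

Section Stationarity.
Context {R : realType} {m n : nat}.
Implicit Types (x h u xi : 'cV[R]_n) (A al : 'M[R]_(m, n)) (b p be : 'cV[R]_m).

Lemma cod_eltE x A u p q : cod_elt x A u p q = (A^T *m q, q *m x^T - p *m u^T, - q).
Proof.
congr (_, _, _); by apply/matrixP => i j; rewrite !mxE !big_ord1 !mxE.
Qed.

Lemma multiplier_gph x A b p :
  multiplier x A b p -> gph (@Fmap R m n) (x, A, b, - (A^T *m p)).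
Proof.
move=> hp; apply/FmapP; split; first by move=> i; case: (hp i).
by exists p.
Qed.

(** The condition [dA^T *m dp = 0] removes the quadratic term of [(A + t *: dA)^T *m (p + t *: dp)].
    The line of multipliers thus maps to a straight segment in the graph. *)
Lemma multiplier_tangent x A b p u xi al be dx dA db dp e : 0 < e ->
  (forall t, 0 < t -> t <= e ->
     multiplier (x + t *: dx) (A + t *: dA) (b + t *: db) (p + t *: dp)) ->
  dA^T *m dp = 0 ->
  proximal_normal (x, A, b, - (A^T *m p)) (gph (@Fmap R m n)) (xi, al, be, - u) ->
  inner xi dx + inner al dA + inner be db
    + inner p (dA *m u) + inner dp (A *m u) <= 0.
Proof.
move=> e0 hm dAp hn.
pose d : 'cV[R]_n * 'M[R]_(m, n) * 'cV[R]_m * 'cV[R]_n := (dx, dA, db, - (dA^T *m p + A^T *m dp)).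
suff -> : inner xi dx + inner al dA + inner be db + inner p (dA *m u) +
    inner dp (A *m u) = inner ((xi, al, be, - u) : 'cV[R]_n * 'M[R]_(m, n) * 'cV[R]_m * 'cV[R]_n) d.
  apply: proximal_normal_tangent e0 _ hn => t t0 te.
  suff -> : (x, A, b, - (A^T *m p)) + t *: d =
      (x + t *: dx, A + t *: dA, b + t *: db, - ((A + t *: dA)^T *m (p + t *: dp))).
    exact/multiplier_gph/hm.
  congr (_, _, _, _) => /=.
  have -> : (A + t *: dA)^T = A^T + t *: dA^T.
    by apply/matrixP => i j; rewrite !mxE.
  rewrite mulmxDl !mulmxDr -!scalemxAl -!scalemxAr dAp.
  by rewrite !scaler0 addr0 scalerN -opprD scalerDr addrAC addrA.
rewrite /inner /= /prod_inner /= /prod_inner /=.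
rewrite -/(inner _ _) innerNl innerNr opprK innerDr ![inner u _]innerC.
by rewrite !inner_trmx_mul !addrA.
Qed.

(** Each conclusion comes from testing the normal along lines that move only some of [x], [A], [b],
    [p]. *)
Lemma proximal_normal_gph x A b p u xi al be :
  multiplier x A b p ->
  proximal_normal (x, A, b, - (A^T *m p)) (gph (@Fmap R m n)) (xi, al, be, - u) ->
  [/\ (xi, al, be) = cod_elt x A u p (- be),
      forall i, p i 0 = 0 -> be i 0 <= 0,
      forall i, (A *m x) i 0 < b i 0 -> be i 0 = 0,
      forall i, (A *m x) i 0 = b i 0 -> (A *m u) i 0 <= 0 &
      forall i, 0 < p i 0 -> (A *m u) i 0 = 0].
Proof.
move=> hp hn.
have tan := fun dx dA db dp e e0 hm dAp =>
  @multiplier_tangent _ _ _ _ _ _ _ _ dx dA db dp e e0 hm dAp hn.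
(* Move [x] by the vector itself and [b] by its image under [A], which keeps [A *m x - b] fixed; the
   test then bounds its square by 0. *)
have xiE : xi + A^T *m be = 0.
  apply: inner_eq0; have := tan (xi + A^T *m be) 0 (A *m (xi + A^T *m be)) 0 1 ltr01.
  rewrite inner0r inner0l mul0mx inner0r !addr0 -inner_trmx_mul -innerDl.
  apply; last by rewrite mulmx0.
  move=> t t0 _ i; have [h1 h2 h3] := hp i.
  rewrite !scaler0 !addr0 mulmx_lineE linecvE.
  by split; [rewrite lerD2r| |rewrite -h3; ring].
(* The same device with [A] moved by [E] and [b] by [E *m x]. *)
have alE : al + be *m x^T + p *m u^T = 0.
  apply: inner_eq0; set E := (X in inner _ X).
  have := tan 0 E (E *m x) 0 1 ltr01.
  rewrite inner0r inner0l add0r addr0 -!inner_outer -!innerDl.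
  apply; last by rewrite mulmx0.
  move=> t t0 _ i; have [h1 h2 h3] := hp i.
  rewrite !scaler0 !addr0 mulmxDl -scalemxAl.
  rewrite !linecvE; by split; [rewrite lerD2r| |rewrite -h3; ring].
(* Move [b i 0] alone: upward ([c = 1]) always, downward ([c = -1]) up to the slack of the row. *)
have beE c i (e : R) : 0 < e -> p i 0 = 0 ->
    (forall t, 0 < t -> t <= e -> (A *m x) i 0 <= b i 0 + t * c) -> c * be i 0 <= 0.
  move=> e0 pi0 hc; have := tan 0 0 (c *: delta_mx i 0) 0 e e0.
  rewrite !inner0r inner0l mul0mx inner0r add0r !addr0 add0r innerZr.
  rewrite inner_cV (bigD1 i) //= big1 => [|j ji]; last first.
    by rewrite mxE (negPf ji) mulr0.
  rewrite mxE !eqxx mulr1 addr0; apply; last by rewrite mulmx0.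
  move=> t t0 te j; have [h1 h2 h3] := hp j; rewrite !scaler0 !addr0.
  rewrite scalerA linecvE [delta_mx _ _ _ _]mxE eqxx andbT.
  have [->|_] := eqVneq j i; last by rewrite mulr0 addr0.
  by rewrite mulr1 pi0 mul0r; split=> //; apply: hc.
(* Move [p i 0] alone: upward on any active row, downward by at most [p i 0]. *)
have AuE c i (e : R) : 0 < e -> (A *m x) i 0 = b i 0 ->
    (forall t, 0 < t -> t <= e -> 0 <= p i 0 + t * c) -> c * (A *m u) i 0 <= 0.
  move=> e0 acti hc; have := tan 0 0 0 (c *: delta_mx i 0) e e0.
  rewrite !inner0r mul0mx inner0r !add0r innerZl.
  rewrite inner_cV (bigD1 i) //= big1 => [|j ji]; last first.
    by rewrite [delta_mx _ _ _ _]mxE (negPf ji) mul0r.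
  rewrite [delta_mx _ _ _ _]mxE !eqxx mul1r addr0; apply; last by rewrite trmx0 mul0mx.
  move=> t t0 te j; have [h1 h2 h3] := hp j; rewrite !scaler0 !addr0.
  rewrite scalerA linecvE [delta_mx _ _ _ _]mxE eqxx andbT.
  have [->|_] := eqVneq j i; last by rewrite mulr0 addr0.
  by rewrite mulr1 acti subrr mulr0; split=> //; apply: hc.
have be_le i : p i 0 = 0 -> be i 0 <= 0.
  move=> pi0; have := beE 1 i 1 ltr01 pi0; rewrite mul1r; apply => t t0 _.
  by case: (hp i) => *; lra.
have Au_le i : (A *m x) i 0 = b i 0 -> (A *m u) i 0 <= 0.
  move=> acti; have := AuE 1 i 1 ltr01 acti; rewrite mul1r; apply => t t0 _.
  by case: (hp i) => *; lra.
have inact i : (A *m x) i 0 < b i 0 -> p i 0 = 0.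
  move=> lti; case: (hp i) => _ _ /eqP; rewrite mulf_eq0 subr_eq0 (lt_eqF lti) orbF.
  by move/eqP.
split=> //.
- rewrite cod_eltE mulmxN opprK mulNmx; congr (_, _, _).
    by apply/eqP; rewrite -addr_eq0 xiE.
  by apply/eqP; rewrite -opprD -addr_eq0 addrA alE.
- move=> i lti; apply/eqP; rewrite eq_le be_le ?inact //=.
  have := beE (-1) i (b i 0 - (A *m x) i 0); rewrite subr_gt0 mulN1r oppr_le0.
  by apply=> //; [exact: inact|move=> t *; lra].
- move=> i p0; have acti : (A *m x) i 0 = b i 0.
    case: (hp i) => _ _ /eqP; rewrite mulf_eq0 (gt_eqF p0) /= subr_eq0.
    by move/eqP.
  apply/eqP; rewrite eq_le Au_le //=.
  have := AuE (-1) i (p i 0) p0 acti; rewrite mulN1r oppr_le0.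
  by apply=> t *; lra.
Qed.

End Stationarity.

(** * Limits of proximal normals *)

Lemma cvg_prod {T : Type} {U V : topologicalType} {F : set_system T} {FF : Filter F}
    {f : T -> U} {g : T -> V} {a : U} {b : V} :
  f @ F --> a -> g @ F --> b -> (f t, g t) @[t --> F] --> (a, b).
Proof. by move=> cf cg; exact: cvg_pair. Qed.

Lemma cvg_prod_fst {T : Type} {U V : topologicalType} {F : set_system T} {FF : Filter F}
    {f : T -> U * V} {a : U} {b : V} : f @ F --> (a, b) -> (f t).1 @[t --> F] --> a.
Proof. by move=> cf; apply: (cvg_comp _ _ cf); exact: cvg_fst. Qed.

Lemma cvg_prod_snd {T : Type} {U V : topologicalType} {F : set_system T} {FF : Filter F}
    {f : T -> U * V} {a : U} {b : V} : f @ F --> (a, b) -> (f t).2 @[t --> F] --> b.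
Proof. by move=> cf; apply: (cvg_comp _ _ cf); exact: cvg_snd. Qed.

Lemma cvg_near0 {R : realType} {T : Type} {F : set_system T} {FF : ProperFilter F}
    {f : T -> R} {a : R} :
  f @ F --> a -> (\forall t \near F, f t = 0) -> a = 0.
Proof.
move=> cf f0; apply/eqP; rewrite eq_le; apply/andP; split.
  by apply: (cvgr_to_le cf); apply: filterS f0 => t ->.
by apply: (cvgr_to_ge cf); apply: filterS f0 => t ->.
Qed.

(** A cluster point of an ultrafilter is a limit, so compactness gives convergence without
    extracting subsequences. *)
Lemma cvg_compact_ultra {R : realType} {T : Type} {F : set_system T} {FU : UltraFilter F}
    (f : T -> R) (a b : R) :
  (\forall t \near F, a <= f t <= b) -> exists l : R, f @ F --> l.
Proof.
move=> fab.
have [|l [_ cl]] := @segment_compact R a b (f @ F) _.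
  by apply: filterS fab => t; rewrite /= in_itv.
exists l => B Bl; have [//|FnB] := in_ultra_setVsetC (f @^-1` B) FU.
by have [t [nBt Bt]] := cl (~` B) B FnB Bl; case: nBt.
Qed.

Section UpperEstimate.
Context {R : realType} {m n : nat}.
Implicit Types (x u xb : 'cV[R]_n) (A Ab : 'M[R]_(m, n)) (b p bb : 'cV[R]_m).

Lemma active_direction xb Ab bb :
  pos_lin_indep [pred i | i \in active xb Ab bb] (fun i => row i Ab) ->
  exists d : 'cV[R]_n, forall i, (Ab *m xb) i 0 = bb i 0 -> 1 <= (Ab *m d) i 0.
Proof.
move=> pli.
have [||d hd] := @gordan R _ m (fun i => i \in active xb Ab bb) (fun i x => (Ab *m x) i 0).
- by move=> i s y z; rewrite [s *: y + z]addrC mulmx_lineE addrC.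
- move=> p p0 hp; apply: pli => //; apply/rowP => j; rewrite summxE mxE.
  rewrite -[RHS](hp (delta_mx j 0)); apply: eq_bigr => i _.
  by rewrite -colE !mxE.
by exists d => i acti; apply: hd; rewrite inE acti.
Qed.

Lemma multiplier_inactive x A b p i :
  multiplier x A b p -> (A *m x) i 0 < b i 0 -> p i 0 = 0.
Proof.
move=> hp lti; have [_ _ /eqP] := hp i.
by rewrite mulf_eq0 subr_eq0 (lt_eqF lti) orbF => /eqP.
Qed.

(** Pair the graph values with the direction [d] of [active_direction]. Near the limit each active
    row has [(A_ t *m d) i 0 > 1 / 2], and the other rows have zero multiplier. *)
Lemma multiplier_bounded {T : Type} {F : set_system T} {FF : Filter F}
    (x_ : T -> 'cV[R]_n) (A_ : T -> 'M[R]_(m, n)) (b_ p_ : T -> 'cV[R]_m)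
    xb Ab bb (vb : 'cV[R]_n) :
  pos_lin_indep [pred i | i \in active xb Ab bb] (fun i => row i Ab) ->
  (forall i, (Ab *m xb) i 0 <= bb i 0) ->
  x_ @ F --> xb -> A_ @ F --> Ab -> b_ @ F --> bb ->
  (- ((A_ t)^T *m p_ t)) @[t --> F] --> vb ->
  (forall t, multiplier (x_ t) (A_ t) (b_ t) (p_ t)) ->
  exists M : R, \forall t \near F, forall i, 0 <= p_ t i 0 <= M.
Proof.
move=> pli Hfeas cx cA cb cv hp; have [d hd] := active_direction _ _ _ pli.
(* The pairing is eventually below [1 - inner vb d] and at least half of every single multiplier. *)
exists (2 * (1 - inner vb d)).
have near_act : \forall t \near F, forall i,
    1 / 2 * p_ t i 0 <= p_ t i 0 * (A_ t *m d) i 0.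
  apply: filter_forall => i.
  have [acti|/eqP neqi] := eqVneq ((Ab *m xb) i 0) (bb i 0).
    have : (A_ t *m d) i 0 @[t --> F] --> (Ab *m d) i 0.
      exact: (cvg_coord (cvg_mulmx cA (cvg_cst d)) i 0).
    have half : 1 / 2 < (Ab *m d) i 0 by have := hd _ acti; lra.
    move=> /cvgr_gt/(_ _ half); apply: filterS => t /ltW ht.
    by rewrite mulrC ler_wpM2l //; case: (hp t i).
  have lti : (Ab *m xb) i 0 - bb i 0 < 0 by rewrite subr_lt0 lt_neqAle Hfeas andbT; apply/eqP.
  have : (A_ t *m x_ t) i 0 - b_ t i 0 @[t --> F] --> (Ab *m xb) i 0 - bb i 0.
    exact: cvgB (cvg_coord (cvg_mulmx cA cx) i 0) (cvg_coord cb i 0).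
  move=> /cvgr_lt/(_ _ lti); apply: filterS => t; rewrite subr_lt0 => ht.
  by rewrite (multiplier_inactive _ _ _ _ _ (hp t) ht) mulr0 mul0r.
have near_v : \forall t \near F, - inner (- ((A_ t)^T *m p_ t)) d < 1 - inner vb d.
  have : - inner (- ((A_ t)^T *m p_ t)) d @[t --> F] --> - inner vb d.
    exact: cvgN (cvg_inner_mx cv (cvg_cst d)).
  by move=> /cvgr_lt; apply; lra.
apply: filterS2 near_act near_v => t hact hv i.
have p0 j : 0 <= p_ t j 0 by case: (hp t j).
rewrite p0 /=; move: hv; rewrite innerNl opprK inner_trmx_mul inner_cV => hv.
have : 1 / 2 * p_ t i 0 <= \sum_j p_ t j 0 * (A_ t *m d) j 0; last by lra.
apply: le_trans (hact i) _; rewrite (bigD1 i) //= lerDl; apply: sumr_ge0 => j _.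
by apply: le_trans (hact j); rewrite mulr_ge0.
Qed.

Lemma coderivative_Fmap_subset xb Ab bb vb u :
  (forall i, (Ab *m xb) i 0 <= bb i 0) ->
  pos_lin_indep [pred i | i \in active xb Ab bb] (fun i => row i Ab) ->
  coderivative (@Fmap R m n) (xb, Ab, bb) vb u `<=`
     \bigcup_(p in Pset xb Ab bb vb u)
       \bigcup_(q in Qset xb Ab bb u p) [set cod_elt xb Ab u p q].
Proof.
move=> Hfeas pli [[xi al] be] /normal_coneP[_ [w_ [n_ [cw cn hn]]]].
pose x_ k := (w_ k).1.1.1; pose A_ k := (w_ k).1.1.2; pose b_ k := (w_ k).1.2.
pose xi_ k := (n_ k).1.1.1; pose al_ k := (n_ k).1.1.2; pose be_ k := (n_ k).1.2.
pose u_ k := - (n_ k).2.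
have pP k : exists p, [/\ multiplier (x_ k) (A_ k) (b_ k) p,
     (w_ k).2 = - ((A_ k)^T *m p) &
     [/\ (xi_ k, al_ k, be_ k) = cod_elt (x_ k) (A_ k) (u_ k) p (- be_ k),
      forall i, p i 0 = 0 -> be_ k i 0 <= 0,
      forall i, (A_ k *m x_ k) i 0 < b_ k i 0 -> be_ k i 0 = 0,
      forall i, (A_ k *m x_ k) i 0 = b_ k i 0 -> (A_ k *m u_ k) i 0 <= 0 &
      forall i, 0 < p i 0 -> (A_ k *m u_ k) i 0 = 0]].
  have := hn k; rewrite /x_ /A_ /b_ /xi_ /al_ /be_ /u_.
  case: (w_ k) (n_ k) => [[[x A] b] v] [[[xi' al'] be'] nu] /= hk.
  have [_ [p hp vE]] := (FmapP _ _ _ _).1 hk.1.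
  exists p; split=> //; apply: (proximal_normal_gph _ _ _ _ _ _ _ _ hp).
  by rewrite opprK -vE.
have [p_ {}pP] := choice pP.
have cx : x_ @ \oo --> xb by exact: cvg_prod_fst (cvg_prod_fst (cvg_prod_fst cw)).
have cA : A_ @ \oo --> Ab by exact: cvg_prod_snd (cvg_prod_fst (cvg_prod_fst cw)).
have cb : b_ @ \oo --> bb by exact: cvg_prod_snd (cvg_prod_fst cw).
have cv : (- ((A_ k)^T *m p_ k)) @[k --> \oo] --> vb.
  rewrite (_ : (fun k => _) = (fun k => (w_ k).2)); first exact: cvg_prod_snd cw.
  by apply/funext => k; case: (pP k).
have cxi : xi_ @ \oo --> xi by exact: cvg_prod_fst (cvg_prod_fst (cvg_prod_fst cn)).
have cal : al_ @ \oo --> al by exact: cvg_prod_snd (cvg_prod_fst (cvg_prod_fst cn)).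
have cbe : be_ @ \oo --> be by exact: cvg_prod_snd (cvg_prod_fst cn).
have cu : u_ @ \oo --> u.
  by rewrite -[u]opprK; apply: cvgN; exact: cvg_prod_snd cn.
have [M hM] := multiplier_bounded _ _ _ _ _ _ _ _ pli Hfeas cx cA cb cv
  (fun k => let: And3 h _ _ := pP k in h).
(* An ultrafilter finer than [\oo] keeps all limits obtained so far and makes the bounded
   multipliers converge. *)
have [U [UU sU]] := ultraFilterLemma (eventually_filter : ProperFilter \oo).
have toU (V : Type) (f : nat -> V) (G : set_system V) : G `<=` f @ \oo -> G `<=` f @ U.
  by move=> cf B /cf; apply: sU.
have {}cx : x_ @ U --> xb by exact: toU cx.
have {}cA : A_ @ U --> Ab by exact: toU cA.
have {}cb : b_ @ U --> bb by exact: toU cb.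
have {}cv : (- ((A_ k)^T *m p_ k)) @[k --> U] --> vb by exact: toU cv.
have {}cxi : xi_ @ U --> xi by exact: toU cxi.
have {}cal : al_ @ U --> al by exact: toU cal.
have {}cbe : be_ @ U --> be by exact: toU cbe.
have {}cu : u_ @ U --> u by exact: toU cu.
have lP i : exists l : R, p_ k i 0 @[k --> U] --> l.
  by apply: (cvg_compact_ultra _ 0 M); apply: sU; apply: filterS hM => k.
have [l {}lP] := choice lP.
pose p : 'cV[R]_m := \col_i l i.
have cp : p_ @ U --> p.
  by apply: cvg_mx => i j; rewrite ord1 mxE; apply: lP.
have cpi i : p_ k i 0 @[k --> U] --> p i 0 by exact: cvg_coord cp i 0.
have cbei i : be_ k i 0 @[k --> U] --> be i 0 by exact: cvg_coord cbe i 0.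
have cAu i : (A_ k *m u_ k) i 0 @[k --> U] --> (Ab *m u) i 0.
  exact: (cvg_coord (cvg_mulmx cA cu) i 0).
have cs i : (A_ k *m x_ k) i 0 - b_ k i 0 @[k --> U] --> (Ab *m xb) i 0 - bb i 0.
  exact: cvgB (cvg_coord (cvg_mulmx cA cx) i 0) (cvg_coord cb i 0).
have hp : multiplier xb Ab bb p.
  move=> i; split=> //.
    by apply: (cvgr_to_ge (cpi i)); apply: nearW => k; case: (pP k) => /(_ i)[].
  apply: (cvg_near0 (cvgM (cpi i) (cs i))).
  by apply: nearW => k; case: (pP k) => /(_ i)[].
have vE : vb = - (Ab^T *m p).
  apply: (cvg_unique _ cv) => //.
  exact: cvgN (cvg_mulmx (cvg_trmx cA) cp).
exists p.
  split; first exact/normal_cone_multiplierP.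
    by rewrite vE opprK.
  move=> i /= p0; apply: (cvg_near0 (cAu i)).
  move: (cpi i) => /cvgr_gt/(_ _ p0); apply: filterS => k.
  by case: (pP k) => _ _ [_ _ _ _]; apply.
exists (- be).
  move=> i; rewrite (_ : (- be) i 0 = - be i 0); last by rewrite mxE.
  split.
    move=> [lti|[acti p0 Au0]]; apply/eqP; rewrite oppr_eq0; apply/eqP.
      apply: (cvg_near0 (cbei i)).
      have lti' : (Ab *m xb) i 0 - bb i 0 < 0 by rewrite subr_lt0.
      move: (cs i) => /cvgr_lt/(_ _ lti'); apply: filterS => k; rewrite subr_lt0.
      by case: (pP k) => _ _ [_ _ + _ _]; apply.
    (* Eventually [(A_ k *m u_ k) i 0 > 0], which no active row allows; the row is inactive and its
       [be_ k] entry vanishes. *)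
    apply: (cvg_near0 (cbei i)).
    move: (cAu i) => /cvgr_gt/(_ _ Au0); apply: filterS => k Auk.
    case: (pP k) => /(_ i)[le_i _ _] _ [_ _ + act _]; apply.
    rewrite lt_neqAle le_i andbT; apply/eqP => /act; by rewrite leNgt Auk.
  move=> [acti p0 Au0]; rewrite oppr_ge0.
  (* Eventually [(A_ k *m u_ k) i 0 < 0], which excludes a positive multiplier; a zero multiplier
     gives the sign of [be_ k]. *)
  apply: (cvgr_to_le (cbei i)).
  move: (cAu i) => /cvgr_lt/(_ _ Au0); apply: filterS => k Auk.
  case: (pP k) => /(_ i)[_ p_ge0 _] _ [_ + _ _ pos]; apply.
  apply/eqP; rewrite eq_le p_ge0 andbT leNgt; apply/negP => /pos Au.
  by rewrite Au ltxx in Auk.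
have codE k : (xi_ k, al_ k) = ((A_ k)^T *m (- be_ k), (- be_ k) *m (x_ k)^T - p_ k *m (u_ k)^T).
  by case: (pP k) => _ _ [+ _ _ _ _]; rewrite cod_eltE => -[-> ->].
have cq : (- be_ k) @[k --> U] --> - be by exact: cvgN cbe.
rewrite /= cod_eltE opprK; congr (_, _, _).
  apply: (cvg_unique _ cxi) => //.
  rewrite (_ : xi_ = fun k => (A_ k)^T *m (- be_ k)); last first.
    by apply/funext => k; case: (codE k).
  exact: cvg_mulmx (cvg_trmx cA) cq.
apply: (cvg_unique _ cal) => //.
rewrite (_ : al_ = fun k => (- be_ k) *m (x_ k)^T - p_ k *m (u_ k)^T); last first.
  by apply/funext => k; case: (codE k).
exact: cvgB (cvg_mulmx cq (cvg_trmx cx)) (cvg_mulmx cp (cvg_trmx cu)).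
Qed.

End UpperEstimate.

(** * Linearly independent active rows *)

Lemma free_dual {K : fieldType} {m n : nat} (A : 'M[K]_(m, n)) (S : {set 'I_m}) :
  free [seq row i A | i in S] ->
  exists c : 'I_m -> 'cV[K]_n,
    forall i j, i \in S -> j \in S -> (A *m c i) j 0 = (j == i)%:R.
Proof.
set X := image_mem _ _ => freeX.
have sizeX : size X = #|S| by rewrite size_map -cardE.
have idx i : i \in S -> (index i (enum S) < size X)%N.
  by move=> Si; rewrite size_map index_mem mem_enum.
have nthX i : i \in S -> X`_(index i (enum S)) = row i A.
  move=> Si; rewrite /X /image_mem (nth_map i) ?nth_index ?mem_enum //.
  by rewrite index_mem mem_enum.
suff /choice[c hc] : forall i, exists c : 'cV[K]_n,
    forall j, i \in S -> j \in S -> (A *m c) j 0 = (j == i)%:R.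
  by exists c.
move=> i; have [Si|_] := boolP (i \in S); last by exists 0.
(* The coordinate functional of row [i] is linear on all row vectors; its values on the unit vectors
   form the dual column. *)
exists (\col_l coord (in_tuple X) (Ordinal (idx i Si)) (delta_mx 0 l)) => j _ Sj.
rewrite mxE; under eq_bigr do rewrite mxE.
have -> : \sum_l A j l * coord (in_tuple X) (Ordinal (idx i Si)) (delta_mx 0 l) =
    coord (in_tuple X) (Ordinal (idx i Si)) (row j A).
  rewrite [row j A]row_sum_delta linear_sum; apply: eq_bigr => l _.
  by rewrite linearZ /= mxE.
have := @coord_free _ _ _ (in_tuple X) (Ordinal (idx j Sj)) (Ordinal (idx i Si)) freeX.
rewrite /= nthX // => ->; congr (_%:R); congr nat_of_bool.
apply/eqP/eqP => [[h]|ji]; last by apply/val_inj; rewrite /= ji.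
by have := congr1 (nth i (enum S)) h; rewrite !nth_index ?mem_enum.
Qed.

Section GraphNormals.
Context {R : realType} {m n : nat}.
Implicit Types (x u : 'cV[R]_n) (A : 'M[R]_(m, n)) (b p q : 'cV[R]_m).

Local Notation graph_space := ('cV[R]_n * 'M[R]_(m, n) * 'cV[R]_m * 'cV[R]_n)%type.

(** The sum norm is dual to the entrywise bounds that the max norm supplies. *)
Let norm1 {k} (y : 'cV[R]_k) : R := \sum_i `|y i 0|.

Lemma norm1_ge0 {k} (y : 'cV[R]_k) : 0 <= norm1 y.
Proof. exact: sumr_ge0. Qed.

Lemma le_norm1 {k} (y : 'cV[R]_k) i : `|y i 0| <= norm1 y.
Proof. by rewrite /norm1 (bigD1 i) //= lerDl sumr_ge0. Qed.

Lemma inner_norm1 {k} (y z : 'cV[R]_k) (e : R) :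
  (forall i, `|y i 0| <= e) -> `|inner y z| <= e * norm1 z.
Proof.
move=> hy; rewrite inner_cV mulr_sumr; apply: le_trans (ler_norm_sum _ _ _) _.
by apply: ler_sum => i _; rewrite normrM ler_wpM2r.
Qed.

Lemma inner_mul_norm1 (B : 'M[R]_(m, n)) q x (e : R) :
  (forall i j, `|B i j| <= e) -> `|inner q (B *m x)| <= e * norm1 x * norm1 q.
Proof.
move=> hB; rewrite innerC; apply: inner_norm1 => i.
rewrite mxE mulr_sumr; apply: le_trans (ler_norm_sum _ _ _) _.
by apply: ler_sum => j _; rewrite normrM ler_wpM2r.
Qed.

Lemma mx_entry_norm {k l} (B : 'M[R]_(k, l)) i j : `|B i j| <= `|B|.
Proof.
rewrite -[`|B|]/(mx_norm B) mx_normrE.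
exact: (le_bigmax _ (fun ij => `|B ij.1 ij.2|) (i, j)).
Qed.

(* The identity [A^T dp = - dv - dA^T p'] determines [dp] through the dual
   vectors [c], up to a term absorbed on the left for small [e]. *)
Lemma multiplier_lipschitz (c : 'I_m -> 'cV[R]_n) (S : {set 'I_m}) A dA p p'
    (dv : 'cV[R]_n) (e : R) :
  (forall i j, i \in S -> j \in S -> (A *m c i) j 0 = (j == i)%:R) ->
  (forall i, i \notin S -> p i 0 = 0) -> (forall i, i \notin S -> p' i 0 = 0) ->
  dv = - ((A + dA)^T *m p') + A^T *m p ->
  0 <= e -> (forall i j, `|dA i j| <= e) -> (forall i, `|dv i 0| <= e) ->
  e * (\sum_i norm1 (c i)) <= 1 / 2 ->
  norm1 (p' - p) <= 2 * (\sum_i norm1 (c i)) * (1 + norm1 p) * e.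
Proof.
move=> hc pS p'S dvE e0 hdA hdv; set K := \sum_i _ => eK.
have K0 : 0 <= K by apply: sumr_ge0 => i _; apply: norm1_ge0.
have dpE i : i \in S -> (p' - p) i 0 = - inner dv (c i) - inner p' (dA *m c i).
  move=> Si; transitivity (inner (p' - p) (A *m c i)).
    rewrite inner_cV (bigD1 i) //= hc // eqxx mulr1 big1 ?addr0 // => j ji.
    have [Sj|Sj] := boolP (j \in S); first by rewrite hc // (negPf ji) mulr0.
    by rewrite subcvE pS // p'S // subr0 mul0r.
  rewrite dvE !(innerDl, innerNl) !inner_trmx_mul mulmxDl innerDr.
  ring.
have norm_p' : norm1 p' <= norm1 p + norm1 (p' - p).
  rewrite /norm1 -big_split; apply: ler_sum => i _ /=.
  by rewrite -{1}[p'](subrK p) addrC mxE; apply: ler_normD.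
have dp_le i : `|(p' - p) i 0| <= e * norm1 (c i) * (1 + norm1 p').
  have [Si|Si] := boolP (i \in S); last first.
    by rewrite subcvE pS // p'S // subr0 normr0 !mulr_ge0 ?norm1_ge0 // addr_ge0 ?norm1_ge0.
  rewrite dpE // mulrDr mulr1; apply: le_trans (ler_normB _ _) _.
  by rewrite normrN lerD ?inner_norm1 ?inner_mul_norm1.
have : norm1 (p' - p) <= e * K * (1 + norm1 p').
  by rewrite /K mulr_sumr mulr_suml; apply: ler_sum.
have := norm1_ge0 p; have := norm1_ge0 (p' - p).
have := norm1_ge0 p'; move: norm_p'.
move: (norm1 p) (norm1 p') (norm1 (p' - p)) => a b d.
have eK0 : 0 <= e * K by rewrite mulr_ge0.
nra.
Qed.

(** The pairing with a graph increment is a first-order part, nonpositive row by row, plus two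
    products of increments. These are quadratically small because [multiplier_lipschitz] bounds
    [p' - p] linearly. *)
Lemma proximal_normal_cod_elt (c : 'I_m -> 'cV[R]_n) x A b p u q :
  multiplier x A b p ->
  (forall i j, i \in active x A b -> j \in active x A b ->
     (A *m c i) j 0 = (j == i)%:R) ->
  (forall i, 0 < p i 0 -> (A *m u) i 0 = 0) ->
  (forall i, (A *m x) i 0 = b i 0 -> p i 0 = 0 -> 0 <= q i 0 /\ (A *m u) i 0 <= 0) ->
  (forall i, (A *m x) i 0 < b i 0 -> q i 0 = 0) ->
  proximal_normal (x, A, b, - (A^T *m p)) (gph (@Fmap R m n))
    (cod_elt x A u p q, - u).
Proof.
move=> hp hc p_pos p_zero inact.
set w : graph_space := (x, A, b, _); apply: proximal_normal_near; first exact: multiplier_gph.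
have [C C0 hC] := @norm_le_innerW R graph_space.
pose K := \sum_i norm1 (c i); pose L := 2 * K * (1 + norm1 p).
have K0 : 0 <= K by apply: sumr_ge0 => i _; apply: norm1_ge0.
have L0 : 0 <= L by rewrite !mulr_ge0 // addr_ge0 // norm1_ge0.
(* Naming the filter keeps [nbhs] of a pair from unfolding to a product filter. *)
have [F FF FE] : exists2 F : set_system graph_space, Filter F & F = nbhs w.
  by exists (nbhs w) => //; exact: nbhs_filter.
(* The summands bound the remainders [inner q (dA *m dx)] and [inner (p' - p) (dA *m u)]; [C]
   converts the squared norm. *)
pose N := (n%:R * norm1 q + norm1 u * L) * C.
suff near_w : \forall z \near F, gph (@Fmap R m n) z ->
    inner ((cod_elt x A u p q, - u) : graph_space) (z - w) <= N * inner (z - w) (z - w).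
  by exists N; move: near_w; rewrite FE.
have cw : id @ F --> (x, A, b, - (A^T *m p)) by rewrite FE.
have near_slack i : \forall z \near F, (A *m x) i 0 < b i 0 ->
    ((z : graph_space).1.1.2 *m z.1.1.1) i 0 < z.1.2 i 0.
  have [lti|_] := ltP ((A *m x) i 0) (b i 0); last exact: nearW.
  have lti' : (A *m x) i 0 - b i 0 < 0 by rewrite subr_lt0.
  have cx : (fun z : graph_space => z.1.1.1) @ F --> x by exact: cvg_prod_fst (cvg_prod_fst (cvg_prod_fst cw)).
  have cA : (fun z : graph_space => z.1.1.2) @ F --> A by exact: cvg_prod_snd (cvg_prod_fst (cvg_prod_fst cw)).
  have cb : (fun z : graph_space => z.1.2) @ F --> b by exact: cvg_prod_snd (cvg_prod_fst cw).
  have : ((z : graph_space).1.1.2 *m z.1.1.1) i 0 - z.1.2 i 0 @[z --> F] --> (A *m x) i 0 - b i 0.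
    exact: cvgB (cvg_coord (cvg_mulmx cA cx) i 0) (cvg_coord cb i 0).
  by move=> /cvgr_lt/(_ _ lti'); apply: filterS => z; rewrite subr_lt0.
have near_dist (e : R) : 0 < e -> \forall z \near F, `|z - w| < e.
  move=> e0; have /cvgrPdist_lt/(_ e e0) := cw.
  by apply: filterS => z; rewrite distrC.
have near_K : \forall z \near F, `|z - w| * K <= 1 / 2.
  have e0 : 0 < 1 / 2 / (1 + K) by rewrite divr_gt0 //; lra.
  apply: filterS (near_dist _ e0) => z; rewrite ltr_pdivlMr; last by lra.
  have := normr_ge0 (z - w); lra.
have near_p i : \forall z \near F, 0 < p i 0 -> L * `|z - w| < p i 0.
  have [p0|_] := ltP 0 (p i 0); last exact: nearW.
  have e0 : 0 < p i 0 / (1 + L) by rewrite divr_gt0 //; lra.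
  apply: filterS (near_dist _ e0) => z; rewrite ltr_pdivlMr; last by lra.
  have := normr_ge0 (z - w); lra.
apply: filterS3 (filter_forall _ near_slack) near_K (filter_forall _ near_p).
move=> [[[x' A'] b'] v'] /= hslack hK hL /FmapP[_ [p' hp' /= v'E]].
have := hC ((x', A', b', v') - w).
have -> : (x', A', b', v') - w = (x' - x, A' - A, b' - b, v' + A^T *m p).
  by rewrite /w -[_ - _]/(x' - x, A' - A, b' - b, v' - - (A^T *m p)) opprK.
move: hK hL.
have -> : (x', A', b', v') - w = (x' - x, A' - A, b' - b, v' + A^T *m p).
  by rewrite /w -[_ - _]/(x' - x, A' - A, b' - b, v' - - (A^T *m p)) opprK.
set dx := x' - x; set dA := A' - A; set db := b' - b; set dv := v' + _.
set d := (dx, dA, db, dv); set e := `|d| => hK hL he.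
have e0 : 0 <= e by apply: normr_ge0.
have [edx edA edv] : [/\ `|dx| <= e, `|dA| <= e & `|dv| <= e].
  by rewrite /e /d !prod_normE /= !le_max !lexx !orbT.
have dA_le i j : `|dA i j| <= e := le_trans (mx_entry_norm _ _ _) edA.
have dx_le i : `|dx i 0| <= e := le_trans (mx_entry_norm _ _ _) edx.
have dv_le i : `|dv i 0| <= e := le_trans (mx_entry_norm _ _ _) edv.
have A'E : A' = A + dA by rewrite addrC subrK.
have lt_inact i : i \notin active x A b -> (A *m x) i 0 < b i 0.
  by rewrite inE => ne; rewrite lt_neqAle ne; case: (hp i).
have dvE : dv = - ((A + dA)^T *m p') + A^T *m p by rewrite -A'E /dv v'E.
have p0 i : i \notin active x A b -> p i 0 = 0.
  by move=> /lt_inact; apply: multiplier_inactive hp.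
have p'0 i : i \notin active x A b -> p' i 0 = 0.
  by move=> /lt_inact/hslack; apply: multiplier_inactive hp'.
have dp_le : norm1 (p' - p) <= L * e.
  exact: multiplier_lipschitz hc p0 p'0 dvE e0 dA_le dv_le hK.
have ndx : norm1 dx <= n%:R * e.
  rewrite mulr_natl -[in X in _ <= X](card_ord n) -sumr_const; exact: ler_sum.
have q_term := inner_mul_norm1 dA q dx e dA_le.
have u_term := inner_mul_norm1 dA (p' - p) u e dA_le.
pose s' := A' *m x' - b'; pose s := A *m x - b.
(* Inactive rows contribute 0. Where [p i 0 = 0] on an active row, the sign conditions apply. Where
   [p i 0 > 0], also [p' i 0 > 0], so the row is active at both points, and [(A *m u) i 0 = 0]. *)
have first_order : inner q (s' - s) + inner (p' - p) (A *m u) <= 0.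
  rewrite !inner_cV -big_split; apply: sumr_le0 => i _ /=.
  rewrite !subcvE; have [le' p'_ge0 comp'] := hp' i; have [_ p_ge0 comp] := hp i.
  have [act|/[dup] nact /lt_inact /inact ->] := boolP (i \in active x A b); last first.
    by rewrite mul0r add0r p0 // p'0 // subr0 mul0r.
  move: act; rewrite inE => /eqP act; rewrite act subrr subr0.
  have [pi0|pi_gt0] := eqVneq (p i 0) 0.
    have [q_ge0 Au_le0] := p_zero i act pi0.
    by rewrite pi0 subr0 -[leRHS](addr0 0) lerD // mulr_ge0_le0 // subr_le0.
  have {}pi_gt0 : 0 < p i 0 by rewrite lt_neqAle eq_sym pi_gt0.
  rewrite p_pos // mulr0 addr0.
  suff p'_gt0 : 0 < p' i 0.
    move/eqP: comp'; rewrite mulf_eq0 (gt_eqF p'_gt0) /= => /eqP ->.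
    by rewrite mulr0.
  have := hL i pi_gt0; have := le_norm1 (p' - p) i; rewrite subcvE.
  have := ler_normB (p i 0) (p' i 0); rewrite distrC.
  have := ler_norm (p i 0 - p' i 0); rewrite distrC; lra.
have sE : s' - s = A *m dx + dA *m x - db + dA *m dx.
    rewrite /s' /s A'E -[x'](subrK x) -/dx -[b'](subrK b) -/db.
    rewrite addrC [dx + x]addrC mulmxDl !mulmxDr.
    apply/matrixP => i j; rewrite !(mxE, subcvE); ring.
clearbody dx dA db dv s s'.
have -> : inner ((cod_elt x A u p q, - u) : graph_space) d =
    inner q (s' - s) + inner (p' - p) (A *m u)
    - inner q (dA *m dx) + inner (p' - p) (dA *m u).
  rewrite cod_eltE sE.
  rewrite -[LHS]/(inner (A^T *m q) dx + inner (q *m x^T - p *m u^T) dA + inner (- q) db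
    + inner (- u) dv) (innerC (- u)) dvE.
  rewrite !(innerDl, innerNl, innerDr, innerNr) !inner_outer !inner_trmx_mul mulmxDl innerDr.
  ring.
have q0 := norm1_ge0 q; have u0 := norm1_ge0 u.
have : e * norm1 dx * norm1 q <= n%:R * norm1 q * e ^+ 2.
  rewrite expr2 [leRHS](_ : _ = e * (n%:R * e) * norm1 q); last by ring.
  by rewrite ler_wpM2r // ler_wpM2l.
have : e * norm1 u * norm1 (p' - p) <= norm1 u * L * e ^+ 2.
  rewrite expr2 [leRHS](_ : _ = e * norm1 u * (L * e)); last by ring.
  by rewrite ler_wpM2l // mulr_ge0.
have := ler_norm (- inner q (dA *m dx)); rewrite normrN.
have := ler_norm (inner (p' - p) (dA *m u)).
have S0 : 0 <= n%:R * norm1 q + norm1 u * L by rewrite addr_ge0 // mulr_ge0.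
have := ler_wpM2l S0 he; rewrite /N mulrA; lra.
Qed.

End GraphNormals.

(** The dual vectors read each multiplier off [A^T *m p], whence uniqueness. *)
Lemma multiplier_dualE {R : realType} {m n : nat} (c : 'I_m -> 'cV[R]_n)
    (x : 'cV[R]_n) (A : 'M[R]_(m, n)) (b p : 'cV[R]_m) i :
  (forall i j, i \in active x A b -> j \in active x A b ->
     (A *m c i) j 0 = (j == i)%:R) ->
  multiplier x A b p ->
  p i 0 = if i \in active x A b then inner (A^T *m p) (c i) else 0.
Proof.
move=> hc hp.
have p0 j : j \notin active x A b -> p j 0 = 0.
  rewrite inE => ne; apply: (multiplier_inactive _ _ _ _ _ hp).
  by rewrite lt_neqAle ne; case: (hp j).
case: ifPn => [Si|/p0 //]; rewrite inner_trmx_mul inner_cV (bigD1 i) //=.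
rewrite hc // eqxx mulr1 big1 ?addr0 // => j ji.
have [Sj|/p0 ->] := boolP (j \in active x A b); last by rewrite mul0r.
by rewrite hc // (negPf ji) mulr0.
Qed.

(* For the limit, slacken the rows with [A_i u > 0] and activate the multipliers
   of the degenerate rows with [A_i u = 0]: along this sequence the sign
   conditions defining [Qset] become those of proximal normals. *)
Lemma cod_elt_coderivative {R : realType} {m n : nat} (c : 'I_m -> 'cV[R]_n)
    (x u : 'cV[R]_n) (A : 'M[R]_(m, n)) (b p q : 'cV[R]_m) :
  (forall i j, i \in active x A b -> j \in active x A b ->
     (A *m c i) j 0 = (j == i)%:R) ->
  multiplier x A b p -> perp_pos A p u -> Qset x A b u p q ->
  coderivative (@Fmap R m n) (x, A, b) (- (A^T *m p)) u (cod_elt x A u p q).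
Proof.
move=> hc hp hu hq; apply/normal_coneP; split; first exact: multiplier_gph.
pose s : 'cV[R]_m := \col_i ((i \in active x A b) && (0 < (A *m u) i 0))%:R.
pose r : 'cV[R]_m :=
  \col_i [&& i \in active x A b, p i 0 == 0 & (A *m u) i 0 == 0]%:R.
have ch (k l : nat) (y z : 'M[R]_(k, l)) : y + harmonic j *: z @[j --> \oo] --> y.
  rewrite -[X in _ --> X]addr0 -(scale0r z); apply: cvgD; first exact: cvg_cst.
  by apply: cvgZr_tmp; exact: cvg_harmonic.
pose b_ k := b + harmonic k *: s; pose p_ k := p + harmonic k *: r.
have cb : b_ @ \oo --> b by exact: ch.
have cp : p_ @ \oo --> p by exact: ch.
have h0 k : 0 < harmonic k :> R by exact: harmonic_gt0.
have pu i : 0 < p i 0 -> (A *m u) i 0 = 0 := hu i.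
exists (fun k => (x, A, b_ k, - (A^T *m p_ k))), (fun k => (cod_elt x A u (p_ k) q, - u)).
split.
- exact: cvg_prod (cvg_prod (cvg_prod (cvg_cst x) (cvg_cst A)) cb)
    (cvgN (cvg_mulmx (cvg_cst A^T) cp)).
- rewrite cod_eltE; under eq_fun do rewrite cod_eltE.
  exact: cvg_prod (cvg_prod (cvg_prod (cvg_cst (A^T *m q))
    (cvgB (cvg_cst (q *m x^T)) (cvg_mulmx cp (cvg_cst u^T)))) (cvg_cst (- q))) (cvg_cst (- u)).
move=> k; have hk := h0 k.
have siE i : s i 0 = ((i \in active x A b) && (0 < (A *m u) i 0))%:R by rewrite mxE.
have riE i : r i 0 = [&& i \in active x A b, p i 0 == 0 & (A *m u) i 0 == 0]%:R.
  by rewrite mxE.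
have sE i : b_ k i 0 = b i 0 + harmonic k * s i 0 by exact: linecvE.
have rE i : p_ k i 0 = p i 0 + harmonic k * r i 0 by exact: linecvE.
have s0 i : 0 <= harmonic k * s i 0 by apply: mulr_ge0 (ltW hk) _; rewrite siE ler0n.
have r0 i : 0 <= harmonic k * r i 0 by apply: mulr_ge0 (ltW hk) _; rewrite riE ler0n.
apply: (proximal_normal_cod_elt c).
(* Slackening respects complementarity: [(A *m u) i 0 > 0] forces [p i 0 = 0], and then [r] vanishes
   there too. *)
- move=> i; have [le_i p0 comp] := hp i; split.
  + by rewrite sE; have := s0 i; lra.
  + by rewrite rE addr_ge0.
  rewrite sE rE siE riE inE.
  have [->|_] := eqVneq; last by rewrite !mulr0 !addr0.
  have [Au_gt0|_] := ltP 0 ((A *m u) i 0); last by rewrite mulr0 addr0 subrr mulr0.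
  rewrite (gt_eqF Au_gt0) andbF mulr0 addr0.
  suff -> : p i 0 = 0 by rewrite mul0r.
  apply/eqP; rewrite eq_le p0 andbT leNgt; apply/negP => /pu Au.
  by rewrite Au ltxx in Au_gt0.
- have act_sub i : i \in active x A (b_ k) -> i \in active x A b.
    rewrite !inE sE => /eqP h; have [le_i _ _] := hp i.
    by rewrite eq_le le_i h lerDl s0.
  by move=> i j /act_sub Si /act_sub Sj; apply: hc.
- move=> i; rewrite rE riE; have [/and3P[_ _ /eqP //]|_] := boolP [&& _, _ & _].
  by rewrite mulr0 addr0; exact: pu.
(* A row still active was not slackened, and a multiplier still zero was not activated. Hence
   [(A *m u) i 0 < 0], and [Qset] gives [0 <= q i 0]. *)
- move=> i; rewrite sE rE => act pi0; have [le_i p0 _] := hp i.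
  have s0' := s0 i; have {}act : (A *m x) i 0 = b i 0 /\ harmonic k * s i 0 = 0 by lra.
  have {}pi0 : p i 0 = 0 /\ harmonic k * r i 0 = 0 by have := r0 i; lra.
  case: act pi0 => act /eqP; rewrite mulf_eq0 (gt_eqF hk) siE inE act eqxx /= => Au.
  move=> [pi0 /eqP]; rewrite mulf_eq0 (gt_eqF hk) riE inE act pi0 !eqxx /= => Au'.
  have {}Au : (A *m u) i 0 <= 0 by rewrite leNgt; apply: contraTN Au => ->; rewrite oner_eq0.
  split=> //; apply: (hq i).2; split=> //; rewrite lt_neqAle Au andbT.
  by apply: contraTN Au' => ->; rewrite oner_eq0.
(* A row inactive here was inactive before or has been slackened; either way [Qset] gives
   [q i 0 = 0]. *)
- move=> i; rewrite sE => lt_i; have [le_i p0 _] := hp i.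
  apply: (hq i).1; have [act|/eqP nact] := eqVneq ((A *m x) i 0) (b i 0); last first.
    by left; rewrite lt_neqAle le_i andbT; apply/eqP.
  right; have Au : 0 < (A *m u) i 0.
    rewrite ltNge; apply/negP => Au; move: lt_i.
    by rewrite siE [0 < (A *m u) i 0]ltNge Au andbF mulr0 addr0 act ltxx.
  split=> //; apply/eqP; rewrite eq_le p0 andbT leNgt; apply/negP => /pu Au0.
  by rewrite Au0 ltxx in Au.
Qed.

Theorem theorem4p3 (R : realType) (m n : nat)
    (xb : 'cV[R]_n) (Ab : 'M[R]_(m, n)) (bb : 'cV[R]_m) (vb : 'cV[R]_n)
    (Hfeas : forall i, (Ab *m xb) i 0 <= bb i 0)
    (Hvb : Fmap (xb, Ab, bb) vb)
    (Hpli : pos_lin_indep [pred i | i \in active xb Ab bb]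
              (fun i => row i Ab)) :
  (forall u : 'cV[R]_n,
     coderivative (@Fmap R m n) (xb, Ab, bb) vb u `<=`
     \bigcup_(p in Pset xb Ab bb vb u)
       \bigcup_(q in Qset xb Ab bb u p) [set cod_elt xb Ab u p q])
  /\
  (free [seq row i Ab | i in active xb Ab bb] ->
   exists pb : 'cV[R]_m,
     unique (fun p => normal_cone (Ab *m xb - bb) (@neg_orthant R m) p /\
                      Ab^T *m p = - vb) pb /\
     forall u : 'cV[R]_n,
       (perp_pos Ab pb u ->
        coderivative (@Fmap R m n) (xb, Ab, bb) vb u =
        \bigcup_(q in Qset xb Ab bb u pb) [set cod_elt xb Ab u pb q]) /\
       (~ perp_pos Ab pb u ->
        coderivative (@Fmap R m n) (xb, Ab, bb) vb u = set0)).
Proof.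
split=> [u|freeS]; first exact: coderivative_Fmap_subset.
have [_ [pb hpb vE]] := (FmapP _ _ _ _).1 Hvb.
have [c hc] := free_dual _ _ freeS.
have pb_unique p : multiplier xb Ab bb p -> Ab^T *m p = - vb -> pb = p.
  move=> hp pE; apply/colP => i.
  by rewrite !(multiplier_dualE c xb Ab bb _ i hc) // pE vE opprK.
exists pb; split.
  split; first by split; [apply/normal_cone_multiplierP|rewrite vE opprK].
  by move=> p [/normal_cone_multiplierP]; apply: pb_unique.
move=> u; have sub := coderivative_Fmap_subset _ _ _ vb u Hfeas Hpli.
split=> hu; apply/seteqP; split.
- move=> z /sub[p [/normal_cone_multiplierP hp /(pb_unique _ hp) <- _]] [q hq ->].
  by exists q.
- by move=> _ [q hq ->]; rewrite vE; apply: cod_elt_coderivative hc _ _ _.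
(* Any element would bring a multiplier orthogonal to [u] in the sense of [perp_pos], and uniqueness
   identifies it with [pb]. *)
- move=> z /sub[p [/normal_cone_multiplierP hp /(pb_unique _ hp) pE pu] _].
  by apply: hu; rewrite pE.
- by [].
Qed.
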